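(* Let $\mathcal I\subset\mathcal N=\{1,\dots,N\}$ with $|\mathcal I|=M$, and let $$\varphi(u,\boldsymbol z;\mathcal I)=\frac{\lambda}{2}\|u\|_{\mathcal U}^2+\frac{\beta}{2M}\sum_{i\in\mathcal I}|[\boldsymbol\phi_i,u]-\boldsymbol z_i|^2+\frac1{2M}\sum_{i\in\mathcal I}|f_i(\boldsymbol z_i)-y_i|^2,\qquad u\in\mathcal U,\ \boldsymbol z\in\mathcal X .$$ Given $\gamma\ge0$ and $\bar{\boldsymbol z}\in\mathcal X$, let $$(u^\dagger,\boldsymbol z^\dagger)=\operatorname{argmin}_{u\in\mathcal U,\ \boldsymbol z\in\mathcal X}\ \varphi(u,\boldsymbol z;\mathcal I)+\frac{\gamma}{2}|\boldsymbol z-\bar{\boldsymbol z}|^2$$ (when $\gamma=0$, the components of $\boldsymbol z^\dagger$ outside $\mathcal I$, on which the objective does not depend, are taken equal to those of $\bar{\boldsymbol z}$). Then $$u^\dagger=\mathcal K(\boldsymbol\phi_{\mathcal I})\Big(\mathcal K(\boldsymbol\phi_{\mathcal I},\boldsymbol\phi_{\mathcal I})+\frac{\lambda M}{\beta}I\Big)^{-1}\boldsymbol z^\dagger_{\mathcal I},$$ where $I$ is the identity matrix and $\boldsymbol z^\dagger=(\bar{\boldsymbol z}_{\mathcal N\setminus\mathcal I},\boldsymbol z^\dagger_{\mathcal I})$ is a solution to $$\min_{\boldsymbol z\in\mathcal X}\ \frac{\lambda}{2}\boldsymbol z_{\mathcal I}^T\Big(\mathcal K(\boldsymbol\phi_{\mathcal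 I},\boldsymbol\phi_{\mathcal I})+\frac{\lambda M}{\beta}I\Big)^{-1}\boldsymbol z_{\mathcal I}+\frac1{2M}\sum_{i\in\mathcal I}|f_i(\boldsymbol z_i)-y_i|^2+\frac{\gamma}{2}|\boldsymbol z-\bar{\boldsymbol z}|^2 .$$
   Context: $\mathcal U$ is a Banach space with dual $\mathcal U^*$, duality pairing $[\cdot,\cdot]$, and a quadratic norm $\|u\|_{\mathcal U}^2=[\mathcal K^{-1}u,u]$, where $\mathcal K:\mathcal U^*\to\mathcal U$ is a linear bijection that is symmetric ($[\mathcal K\phi,\psi]=[\mathcal K\psi,\phi]$) and positive ($[\mathcal K\phi,\phi]>0$ for $\phi\neq0$). For each $i\in\mathcal N$: $\boldsymbol\phi_i\in(\mathcal U^* )^{\otimes N_i}$ is an $N_i$-tuple of elements of $\mathcal U^*$; $[\boldsymbol\phi_i,u]\in\mathbb R^{N_i}$ is the vector of pairings of its entries with $u$; $f_i:\mathbb R^{N_i}\to\mathbb R$ is a function and $y_i\in\mathbb R$ a datum. $\mathcal X=\prod_{i=1}^N\mathcal X_i$ with each $\mathcal X_i\subset\mathbb R^{N_i}$ convex and compact, $0\in\mathcal X$. $\lambda,\beta>0$; $|\cdot|$ is the Euclidean norm. For $\boldsymbol z=(\boldsymbol z_1,\dots,\boldsymbol z_N)$ and an index set $\mathcal J\subset\mathcal N$, $\boldsymbol z_{\mathcal J}$ is the vector of the blocks $\boldsymbol z_i$, $i\in\mathcal J$. $\boldsymbol\phi_{\mathcal I}$ is the concatenation of the tuples $\boldsymbol\phi_i$,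 $i\in\mathcal I$, with entries denoted $\phi_1,\dots,\phi_m\in\mathcal U^*$, $m=\sum_{i\in\mathcal I}N_i$. $\mathcal K(\boldsymbol\phi_{\mathcal I})$ is the row vector $(\mathcal K\phi_1,\dots,\mathcal K\phi_m)$ of elements of $\mathcal U$, so $\mathcal K(\boldsymbol\phi_{\mathcal I})c=\sum_jc_j\mathcal K\phi_j$ for $c\in\mathbb R^m$, and $\mathcal K(\boldsymbol\phi_{\mathcal I},\boldsymbol\phi_{\mathcal I})$ is the $m\times m$ matrix with entries $[\phi_j,\mathcal K\phi_l]$. *)

(* Defs.v *)
From HB Require Import structures.
From mathcomp Require Import all_boot all_order all_algebra.
From mathcomp Require Import all_classical all_reals all_analysis.

Set Implicit Arguments.
Unset Strict Implicit.
Unset Printing Implicit Defensive.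

Import Order.TTheory GRing.Theory Num.Theory.
Import numFieldNormedType.Exports.

Local Open Scope classical_set_scope.
Local Open Scope ring_scope.

Section Dual.
Context {R : realType} (U : normedModType R).

Definition linear_continuous_pred : {pred U -> R^o} :=
  mem [set phi : U -> R^o | linear phi /\ continuous phi].

Record dual_space := Dual {
  dual_fun :> U -> R^o ;
  dualP : dual_fun \in linear_continuous_pred }.

HB.instance Definition _ := [isSub for dual_fun].
HB.instance Definition _ := [Choice of dual_space by <:].

Lemma linear_continuous_submod_closed : submod_closed linear_continuous_pred.
Proof.
split; first by rewrite inE; split=> [a x y|]; [rewrite scaler0 addr0|exact: cst_continuous].
move=> a phi psi /set_mem[phil phic] /set_mem[psil psic]; rewrite inE.
split=> [b x y|x].
  by rewrite !fctE phil psil !scalerDr !scalerA mulrC addrACA.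
by apply: cvgD (psic x); exact: (cvgZl_tmp (phic x)).
Qed.

HB.instance Definition _ := GRing.isSubmodClosed.Build R (U -> R^o)
  linear_continuous_pred linear_continuous_submod_closed.
HB.instance Definition _ := [SubChoice_isSubLmodule of dual_space by <:].

End Dual.

Section Blocks.
Context {N : nat} (n : 'I_N -> nat).

Definition blocks (T : Type) := forall i, 'cV[T]_(n i).

(* Total length of the blocks indexed by [I]; the shape of the sum over ['I_#|I|]
   is the one required by [\mxcol], and [enum_val] lists [I] in increasing order. *)
Definition blocks_size (I : {set 'I_N}) : nat := (\sum_(k < #|I|) n (enum_val k))%N.

Definition subblocks (T : Type) (I : {set 'I_N}) (z : blocks T) :
    'cV[T]_(blocks_size I) :=
  \mxcol_(k < #|I|) z (enum_val k).

Definition prod_set (T : Type) (X : forall i, set 'cV[T]_(n i)) : set (blocks T) :=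
  [set z | forall i, X i (z i)].

End Blocks.

(* The library's [`|v|] on ['cV_m] is the sup norm. *)
Definition enorm {R : realType} {m : nat} (v : 'cV[R]_m) : R :=
  Num.sqrt (\sum_i v i 0 ^+ 2).

Definition argmin {R : realType} {T : Type} (A : set T) (F : T -> R) : set T :=
  [set x | A x /\ forall y, A y -> F x <= F y].

Section Functionals.
Context {R : realType} {U : normedModType R}.

Definition pairing {m} (phi : 'cV[dual_space U]_m) (u : U) : 'cV[R]_m :=
  \col_j phi j 0 u.

Definition Krow (K : dual_space U -> U) {m} (phi : 'cV[dual_space U]_m) : 'rV[U]_m :=
  \row_j K (phi j 0).

Definition lincomb {m} (v : 'rV[U]_m) (c : 'cV[R]_m) : U :=
  \sum_j c j 0 *: v 0 j.

Definition Kmx (K : dual_space U -> U) {m} (phi : 'cV[dual_space U]_m) : 'M[R]_m :=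
  \matrix_(j, l) phi j 0 (K (phi l 0)).

Context {N : nat} (n : 'I_N -> nat).

Definition objective (phi : blocks n (dual_space U)) (f : forall i, 'cV[R]_(n i) -> R)
    (y : 'I_N -> R) (lambda beta : R) (I : {set 'I_N}) (u : U) (z : blocks n R) : R :=
  lambda / 2 * `|u| ^+ 2
  + beta / (2 * #|I|%:R) * \sum_(i in I) enorm (pairing (phi i) u - z i) ^+ 2
  + 1 / (2 * #|I|%:R) * \sum_(i in I) `|f i (z i) - y i| ^+ 2.

Definition proximal (gamma : R) (zbar z : blocks n R) : R :=
  gamma / 2 * enorm (\mxcol_(i < N) (z i - zbar i)) ^+ 2.

Definition reg_Kmx (K : dual_space U -> U) (phi : blocks n (dual_space U)) (lambda beta : R)
    (I : {set 'I_N}) : 'M[R]_(blocks_size n I) :=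
  Kmx K (subblocks I phi) + (lambda * #|I|%:R / beta)%:M.

Definition reduced_objective (K : dual_space U -> U) (phi : blocks n (dual_space U))
    (f : forall i, 'cV[R]_(n i) -> R) (y : 'I_N -> R) (lambda beta : R)
    (I : {set 'I_N}) (z : blocks n R) : R :=
  lambda / 2 * ((subblocks I z)^T *m invmx (reg_Kmx K phi lambda beta I)
                *m subblocks I z) 0 0
  + 1 / (2 * #|I|%:R) * \sum_(i in I) `|f i (z i) - y i| ^+ 2.

End Functionals.

(* Main.v *)
(* Writing a = G^-1 z_I with G the regularized Gram matrix and u0 = K(phi_I) a,
   the objective is the reduced objective plus a positive definite quadratic
   form in u - u0: minimizing over u gives u = u0 and leaves the reduced problem.
   Blocks outside I only enter the proximal term, hence stay at zbar. *)
Require Import Defs.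
From HB Require Import structures.
From mathcomp Require Import all_boot all_order all_algebra.
From mathcomp Require Import all_classical all_reals all_analysis.
From mathcomp Require Import ring.

Import Order.TTheory GRing.Theory Num.Theory.
Import numFieldNormedType.Exports.
Local Open Scope classical_set_scope.
Local Open Scope ring_scope.

Section Dot.
Context {R : realType}.

Definition dot {m} (v w : 'cV[R]_m) : R := (v^T *m w) 0 0.

Lemma enorm_sqr {m} (v : 'cV[R]_m) : enorm v ^+ 2 = dot v v.
Proof.
rewrite /enorm sqr_sqrtr; last by apply: sumr_ge0 => i _; exact: sqr_ge0.
by rewrite /dot mxE; apply: eq_bigr => i _; rewrite mxE expr2.
Qed.

Lemma dotC {m} (v w : 'cV[R]_m) : dot v w = dot w v.
Proof.
by rewrite /dot [LHS]mxE [RHS]mxE; apply: eq_bigr => i _; rewrite !mxE mulrC.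
Qed.

Lemma dotDr {m} (v w1 w2 : 'cV[R]_m) : dot v (w1 + w2) = dot v w1 + dot v w2.
Proof. by rewrite /dot mulmxDr mxE. Qed.

Lemma dotZr {m} (c : R) (v w : 'cV[R]_m) : dot v (c *: w) = c * dot v w.
Proof. by rewrite /dot -scalemxAr mxE. Qed.

Lemma dot_subZ {m} (c : R) (v w : 'cV[R]_m) :
  dot (v - c *: w) (v - c *: w) = dot v v - 2 * c * dot w v + c ^+ 2 * dot w w.
Proof.
rewrite -scaleNr !(dotDr, dotZr) ![dot (_ + _) _]dotC !(dotDr, dotZr) [dot v w]dotC.
by ring.
Qed.

Lemma enorm_sqr_eq0 {m} (v : 'cV[R]_m) : enorm v ^+ 2 = 0 -> v = 0.
Proof.
rewrite enorm_sqr /dot mxE => /eqP; rewrite psumr_eq0 => [/allP v0|i _].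
  apply/colP => i; have := v0 i (mem_index_enum _).
  by rewrite !mxE -expr2 sqrf_eq0 => /eqP.
by rewrite mxE -expr2 sqr_ge0.
Qed.

Lemma enorm0 {m} : enorm (0 : 'cV[R]_m) = 0.
Proof. by apply/eqP; rewrite -sqrf_eq0 enorm_sqr /dot mulmx0 mxE. Qed.

Lemma enorm_mxcol_sqr {p} {q : 'I_p -> nat} (w : forall i, 'cV[R]_(q i)) :
  enorm (\mxcol_(i < p) w i) ^+ 2 = \sum_(i < p) enorm (w i) ^+ 2.
Proof.
rewrite enorm_sqr /dot tr_mxcol mul_mxrow_mxcol summxE.
by apply: eq_bigr => i _; rewrite enorm_sqr.
Qed.

Lemma enorm_subblocks_sqr {N} {n : 'I_N -> nat} (I : {set 'I_N})
    (z : blocks n R) :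
  enorm (subblocks I z) ^+ 2 = \sum_(i in I) enorm (z i) ^+ 2.
Proof.
by rewrite enorm_mxcol_sqr [RHS]big_enum_val.
Qed.

End Dot.

Section Dual.
Context {R : realType} {U : normedModType R}.
Implicit Types (phi : dual_space U) (u v : U).

Lemma dual_linear phi : linear phi.
Proof. by have /set_mem[] := dualP phi. Qed.

HB.instance Definition _ phi :=
  GRing.isLinear.Build R U R^o *:%R (phi : U -> R^o) (dual_linear phi).

Lemma dualD phi u v : phi (u + v) = phi u + phi v.
Proof. exact: linearD. Qed.

Lemma dual_sumE {m} (phi : 'cV[dual_space U]_m) (a : 'cV[R]_m) u :
  (\sum_j a j 0 *: phi j 0) u = dot a (pairing phi u).
Proof.
rewrite /dot mxE; under [RHS]eq_bigr do rewrite !mxE.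
(* Sums and multiples in [dual_space] evaluate pointwise by conversion, so the two sums are built in
   parallel. *)
by elim/big_rec2: _ => [//|j x psi _ <-].
Qed.

Lemma pairingB {m} (phi : 'cV[dual_space U]_m) u v :
  pairing phi (u - v) = pairing phi u - pairing phi v.
Proof. by apply/colP => j; rewrite !mxE linearB. Qed.

End Dual.

Section Gram.
Context {R : realType} {U : normedModType R} (K : {linear dual_space U -> U}).
Hypothesis K_sym : forall phi psi : dual_space U, psi (K phi) = phi (K psi).
Context {m : nat} (phi : 'cV[dual_space U]_m).

Lemma lincomb_Krow (a : 'cV[R]_m) :
  lincomb (Krow K phi) a = K (\sum_j a j 0 *: phi j 0).
Proof. by rewrite linear_sum; apply: eq_bigr => j _; rewrite mxE linearZ. Qed.

Lemma pairing_lincomb (a : 'cV[R]_m) :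
  pairing phi (lincomb (Krow K phi) a) = Kmx K phi *m a.
Proof.
apply/colP => j; rewrite lincomb_Krow mxE K_sym dual_sumE /dot !mxE.
by apply: eq_bigr => l _; rewrite !mxE mulrC K_sym.
Qed.

(** A kernel vector [v] annihilates the quadratic form, which is [psi (K psi)] for the combination
    [psi] of the functionals with coefficients [v], plus [c] times the squared norm of [v]. *)
Lemma Kmx_shift_unit (c : R) :
  (forall phi : dual_space U, phi != 0 -> 0 < phi (K phi)) ->
  0 < c -> Kmx K phi + c%:M \in unitmx.
Proof.
(* [det0P] yields a row vector in the left kernel; transposing first makes it a right kernel
   vector. *)
move=> K_pos c0; rewrite -unitmx_tr unitmxE unitfE; apply/negP => /det0P[v v0].
move=> /(congr1 trmx); rewrite trmx_mul trmxK trmx0.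
rewrite mulmxDl mul_scalar_mx => vG.
have : dot v^T (Kmx K phi *m v^T + c *: v^T) = 0 by rewrite vG /dot mulmx0 mxE.
have Kv : 0 <= dot v^T (Kmx K phi *m v^T).
  rewrite -pairing_lincomb -dual_sumE lincomb_Krow.
  (* The functionals may be dependent, so [psi] can vanish for nonzero [v]; strictness comes from
     the shift [c]. *)
  set psi := \sum_j _; have [->|/K_pos/ltW//] := eqVneq psi 0.
  by rewrite linear0 linear0.
rewrite dotDr dotZr -enorm_sqr => /eqP.
rewrite paddr_eq0 ?(mulr_ge0 (ltW c0) (sqr_ge0 _))// => /andP[_].
rewrite mulf_eq0 gt_eqF//= => /eqP /enorm_sqr_eq0 /(congr1 trmx).
by rewrite trmxK trmx0 => /eqP; rewrite (negbTE v0).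
Qed.

Context (Kinv : U -> dual_space U) (K_Kinv : cancel K Kinv)
  (Kinv_K : cancel Kinv K)
  (norm_quadratic : forall u : U, `|u| ^+ 2 = Kinv u u).

Lemma norm_addK_sqr (psi : dual_space U) (w : U) :
  `|w + K psi| ^+ 2 = `|w| ^+ 2 + 2 * psi w + psi (K psi).
Proof.
(* [Kinv] is a plain function: its additivity is drawn from that of [K] by writing [w] as
   [K (Kinv w)]. By symmetry both cross terms then equal [psi w]. *)
rewrite !norm_quadratic -{1 2}[w]Kinv_K -linearD K_Kinv.
have -> : (Kinv w + psi) (K (Kinv w + psi)) =
  Kinv w (K (Kinv w + psi)) + psi (K (Kinv w + psi)) by [].
rewrite linearD !dualD [Kinv w (K psi)]K_sym Kinv_K.
by ring.
Qed.

(** Expand around [u0]. The cross terms are [2 * al] and [- 2 * be * c] times the same product of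
    [a] with the pairing of [u - u0], so [al = be * c] cancels them. The constant terms add up to
    [al * dot z a]. *)
Lemma complete_square (al be c : R) (z : 'cV[R]_m) (u : U) :
  al = be * c -> Kmx K phi + c%:M \in unitmx ->
  let u0 := lincomb (Krow K phi) (invmx (Kmx K phi + c%:M) *m z) in
  al * `|u| ^+ 2 + be * enorm (pairing phi u - z) ^+ 2 =
  al * (z^T *m invmx (Kmx K phi + c%:M) *m z) 0 0
  + (al * `|u - u0| ^+ 2 + be * enorm (pairing phi (u - u0)) ^+ 2).
Proof.
move=> ->; set G := _ + _ => Gu u0.
set a := invmx G *m z in u0 *.
have za : z = Kmx K phi *m a + c *: a.
  by rewrite -mul_scalar_mx -mulmxDl mulKVmx.
rewrite -mulmxA -/(dot z a).
(* The Gram part of [z] is exactly the pairing with [u0]. *)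
have -> : pairing phi u - z = pairing phi (u - u0) - c *: a.
  by rewrite {1}za pairingB pairing_lincomb opprD addrA.
rewrite -{1}[u](subrK u0) {2}/u0 lincomb_Krow norm_addK_sqr -lincomb_Krow -/u0.
rewrite !dual_sumE pairing_lincomb !enorm_sqr dot_subZ [dot z a]dotC {1}za dotDr dotZr.
by ring.
Qed.

End Gram.

Theorem lemma2p5 (R : realType) (U : completeNormedModType R)
    (K : {linear dual_space U -> U}) (Kinv : U -> dual_space U)
    (K_Kinv : cancel K Kinv) (Kinv_K : cancel Kinv K)
    (K_sym : forall phi psi : dual_space U, psi (K phi) = phi (K psi))
    (K_pos : forall phi : dual_space U, phi != 0 -> 0 < phi (K phi))
    (norm_quadratic : forall u : U, `|u| ^+ 2 = Kinv u u)
    (N : nat) (n : 'I_N -> nat)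
    (phi : blocks n (dual_space U)) (f : forall i, 'cV[R]_(n i) -> R) (y : 'I_N -> R)
    (X : forall i, set 'cV[R]_(n i))
    (X_convex : forall i, convex_set (X i))
    (X_compact : forall i, compact (X i))
    (X0 : prod_set X (fun=> 0))
    (lambda beta : R) (lambda_gt0 : 0 < lambda) (beta_gt0 : 0 < beta)
    (I : {set 'I_N}) (I_neq0 : (0 < #|I|)%N)
    (gamma : R) (gamma_ge0 : 0 <= gamma)
    (zbar : blocks n R) (zbarX : prod_set X zbar)
    (udag : U) (zdag : blocks n R)
    (dag_argmin :
       argmin ([set: U] `*` prod_set X)
         (fun uz => objective phi f y lambda beta I uz.1 uz.2
                    + proximal gamma zbar uz.2)
         (udag, zdag))
    (dag_gamma0 : gamma = 0 -> forall i, i \notin I -> zdag i = zbar i) :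
  [/\ reg_Kmx K phi lambda beta I \in unitmx,
      udag = lincomb (Krow K (subblocks I phi))
               (invmx (reg_Kmx K phi lambda beta I) *m subblocks I zdag),
      (forall i, i \notin I -> zdag i = zbar i)
    & argmin (prod_set X)
        (fun z => reduced_objective K phi f y lambda beta I z
                  + proximal gamma zbar z)
        zdag].
Proof.
have M_gt0 : 0 < #|I|%:R :> R by rewrite ltr0n.
have c_gt0 : 0 < lambda * #|I|%:R / beta by rewrite divr_gt0 ?mulr_gt0.
have al_gt0 : 0 < lambda / 2 by rewrite divr_gt0.
have be_ge0 : 0 <= beta / (2 * #|I|%:R) by rewrite divr_ge0 ?mulr_ge0 ?ltW.
(* This balance of the two weights dictates the size of the regularizing shift. *)
have alE : lambda / 2 = beta / (2 * #|I|%:R) * (lambda * #|I|%:R / beta).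
  by field; rewrite !gt_eqF.
have G_unit : reg_Kmx K phi lambda beta I \in unitmx by exact: Kmx_shift_unit.
pose u0 (z : blocks n R) := lincomb (Krow K (subblocks I phi))
  (invmx (reg_Kmx K phi lambda beta I) *m subblocks I z).
pose excess u z := lambda / 2 * `|u - u0 z| ^+ 2
  + beta / (2 * #|I|%:R) * enorm (pairing (subblocks I phi) (u - u0 z)) ^+ 2.
pose red := reduced_objective K phi f y lambda beta I.
have objE u z : objective phi f y lambda beta I u z = red z + excess u z.
  rewrite /objective -(enorm_subblocks_sqr I (fun i => pairing (phi i) u - z i)).
  have -> : subblocks I (fun i => pairing (phi i) u - z i) =
            pairing (subblocks I phi) u - subblocks I z.
    by apply/colP => j; rewrite !mxE.
  by rewrite (complete_square _ K_sym _ _ K_Kinv Kinv_K norm_quadratic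
    _ _ _ _ _ alE) // addrAC.
have [[_ zdagX] dag_min] := dag_argmin.
have excess_ge0 : 0 <= excess udag zdag.
  exact: addr_ge0 (mulr_ge0 (ltW al_gt0) (sqr_ge0 _)) (mulr_ge0 be_ge0 (sqr_ge0 _)).
(* Test minimality against [(u0 z, z)], where the excess vanishes; all three remaining claims follow
   from this inequality. *)
have min_red z : prod_set X z ->
    red zdag + excess udag zdag + proximal gamma zbar zdag
    <= red z + proximal gamma zbar z.
  move=> zX; have /= := dag_min (u0 z, z) (conj Logic.I zX).
  rewrite !objE [excess _ z]/excess subrr normr0.
  have -> : pairing (subblocks I phi) (0 : U) = 0.
    by apply/colP => j; rewrite !mxE linear0.
  by rewrite enorm0 expr0n !mulr0 !addr0.
split => //.
(* Taking [z = zdag] forces the excess to be at most 0; its norm term has positive weight, hence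
   [udag = u0 zdag]. *)
- have := min_red _ zdagX.
  rewrite lerD2r gerDl => excess_le0.
  have /eqP : excess udag zdag = 0 by apply/le_anti/andP.
  rewrite paddr_eq0 ?(mulr_ge0 (ltW al_gt0) (sqr_ge0 _))
    ?(mulr_ge0 be_ge0 (sqr_ge0 _))// => /andP[+ _].
  by rewrite mulf_eq0 gt_eqF//= sqrf_eq0 normr_eq0 subr_eq0 => /eqP.
- have [/dag_gamma0//|gamma_neq0] := eqVneq gamma 0.
  (* For positive [gamma], resetting the blocks outside [I] to [zbar] keeps [red] and can only lower
     the proximal term. *)
  pose z i := if i \in I then zdag i else zbar i.
  have zX : prod_set X z by move=> i; rewrite /z; case: ifP.
  have redz : red z = red zdag.
    rewrite /red /reduced_objective.
    have -> : subblocks I z = subblocks I zdag.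
      by apply/colP => j; rewrite !mxE /z enum_valP.
    by congr (_ + _ * _); apply: eq_bigr => i iI; rewrite /z iI.
  have : proximal gamma zbar zdag <= proximal gamma zbar z.
    rewrite -(lerD2l (red zdag)) -{2}redz; apply: le_trans (min_red z zX).
    by rewrite lerD2r lerDl.
  rewrite /proximal ler_pM2l; last by rewrite divr_gt0// lt_def gamma_neq0.
  (* The parts over [I] cancel and the competitor's part outside [I] is 0, so a sum of squares is at
     most 0. *)
  rewrite !enorm_mxcol_sqr (bigID (mem I)) /= [leRHS](bigID (mem I)) /=.
  have -> : \sum_(i in I) enorm (z i - zbar i) ^+ 2 =
            \sum_(i in I) enorm (zdag i - zbar i) ^+ 2.
    by apply: eq_bigr => i iI; rewrite /z iI.
  rewrite lerD2l [leRHS]big1 => [sum_le0 i iI|i iI]; last first.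
    by rewrite /z (negbTE iI) subrr enorm0 expr0n.
  apply/eqP; rewrite -subr_eq0; apply/eqP/enorm_sqr_eq0/le_anti.
  rewrite sqr_ge0 andbT (le_trans _ sum_le0)// (bigD1 i)//= lerDl.
  by apply: sumr_ge0 => j _; rewrite sqr_ge0.
(* Only the nonnegative excess of the minimizer is dropped. *)
- split=> // z zX; apply: le_trans (min_red z zX).
  by rewrite lerD2r lerDl.
Qed.
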